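(* Every uniformly smooth Banach space over $\mathbb{K}$ has the BPB property.
   Context: $\mathbb{K}$ is $\mathbb{R}$ or $\mathbb{C}$; $B_Y$, $S_Y$, $Y^*$ denote the closed unit ball, the unit sphere and the dual of $Y$. A Banach space $Y$ is uniformly smooth if the limit $\lim_{\alpha\to 0}\frac{\|u+\alpha y\|-1}{\alpha}$ ($\alpha$ real) exists uniformly for $y\in B_Y$ and $u\in S_Y$. For a closed subspace $X$ of $Y$, $\Pi(X,Y)=\{(x,y^* )\in S_X\times S_{Y^*} : y^*(x)=1\}$. The pair $(X,Y)$ is a BPB-pair if for every $\varepsilon>0$ there exists $\delta>0$ such that whenever $x_0\in S_X$, $y_0^*\in S_{Y^*}$ satisfy $\mathrm{Re}\,y_0^*(x_0)>1-\delta$, there exists $(x,y^* )\in\Pi(X,Y)$ with $\|x_0-x\|<\varepsilon$ and $\|y_0^*-y^*\|<\varepsilon$. $Y$ has the BPB property if $(X,Y)$ is a BPB-pair for every closed subspace $X$ of $Y$. *)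

(* Defs.v *)
From HB Require Import structures.
From mathcomp Require Import all_boot all_order all_algebra.
From mathcomp Require Import all_classical all_reals all_analysis.
From mathcomp Require Import complex.

Set Implicit Arguments.
Unset Strict Implicit.
Unset Printing Implicit Defensive.

Import Order.TTheory GRing.Theory Num.Theory.
Import numFieldNormedType.Exports.

Local Open Scope classical_set_scope.
Local Open Scope ring_scope.

Variant scalar_kind := RealScalars | ComplexScalars.

Definition scalar_field (R : realType) (k : scalar_kind) : numFieldType :=
  match k with
  | RealScalars => R
  | ComplexScalars => R[i]
  end.

Definition re_scalar (R : realType) (k : scalar_kind) : scalar_field R k -> R :=
  match k with
  | RealScalars => fun z : R => z
  | ComplexScalars => fun z : R[i] => complex.Re z
  end.

Definition of_real (R : realType) (k : scalar_kind) : R -> scalar_field R k :=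
  match k with
  | RealScalars => fun a : R => a
  | ComplexScalars => fun a : R => (a%:C)%C
  end.

Section BPB.
Variables (R : realType) (k : scalar_kind).
Local Notation K := (scalar_field R k).
Variable Y : completeNormedModType K.

(* In MathComp the norm of a normed space over K takes values in K itself, so
   over the complex numbers it is a complex number with zero imaginary part. *)
Definition rnorm (V : normedModType K) (v : V) : R := re_scalar `|v|.

Definition unit_ball : set Y := [set y | rnorm y <= 1].

Definition unit_sphere : set Y := [set y | rnorm y = 1].

Definition difference_quotient (a : R) (uy : Y * Y) : R :=
  (rnorm (uy.1 + of_real k a *: uy.2) - 1) / a.

Definition uniformly_smooth : Prop :=
  exists L : Y * Y -> R,
    {uniform unit_sphere `*` unit_ball, difference_quotient @ 0^' --> L}.

(* The set over which the supremum is taken is bounded when f is linear and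
   continuous; opnorm is only applied to such f. *)
Definition opnorm (f : Y -> K^o) : R :=
  sup [set rnorm (f y) | y in unit_ball].

Definition dual : set {linear Y -> K^o} := [set f | continuous f].

Definition dual_sphere : set {linear Y -> K^o} :=
  dual `&` [set f | opnorm f = 1].

Definition closed_subspace (X : set Y) : Prop :=
  closed X /\ submod_closed (mem X).

Definition Pi_set (X : set Y) : set (Y * {linear Y -> K^o}) :=
  [set p | [/\ (X `&` unit_sphere) p.1, dual_sphere p.2 & p.2 p.1 = 1]].

Definition BPB_pair (X : set Y) : Prop :=
  forall eps : R, 0 < eps ->
  exists2 delta : R, 0 < delta &
    forall (x0 : Y) (y0 : {linear Y -> K^o}),
      (X `&` unit_sphere) x0 -> dual_sphere y0 ->
      1 - delta < re_scalar (y0 x0) ->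
      exists p : Y * {linear Y -> K^o},
        [/\ Pi_set X p, rnorm (x0 - p.1) < eps & opnorm (y0 \- p.2) < eps].

Definition BPB_property : Prop :=
  forall X : set Y, closed_subspace X -> BPB_pair X.

End BPB.

(* Main.v *)
From HB Require Import structures.
Require Import Defs.
From mathcomp Require Import all_boot all_order all_algebra.
From mathcomp Require Import all_classical all_reals all_analysis.
From mathcomp Require Import complex lra ring.

Set Implicit Arguments.
Unset Strict Implicit.
Unset Printing Implicit Defensive.

Import Order.TTheory GRing.Theory Num.Theory.
Import numFieldNormedType.Exports.

Local Open Scope classical_set_scope.
Local Open Scope ring_scope.

(** In a uniformly smooth space a functional that almost attains its norm at a
    unit vector x0 must itself be close to the derivative of the norm at x0.
    The point therefore never has to be moved: the pair required by the
    Bishop-Phelps-Bollobas property is (x0, f), where f is the functional whose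
    real part is that derivative, and since x0 stays in every subspace it
    belongs to, one proof serves for all closed subspaces at once.

    For the estimate, let G be the derivative of the norm at x0 and let a > 0
    be such that |x0 + a y| <= 1 + a (G y + eps / 4) for all y in the unit
    ball; uniform smoothness provides such an a that does not depend on x0
    ([uniformly_smooth_norm_derivative]). If y0 has norm 1 and
    Re y0(x0) > 1 - a eps / 4, then

      1 - a eps / 4 + a Re y0(y) < Re y0(x0 + a y) <= 1 + a (G y + eps / 4),

    so Re (y0 - f)(y) < eps / 2 on the unit ball, and rotating y by scalars of
    modulus one turns this into a bound on the norm of y0 - f ([opnorm_le]).

    It remains to produce f ([exists_support_functional]). Convexity of the
    norm together with the two-sidedness of the limit makes G additive
    ([norm_derivativeD]), so G is a real-linear functional with G y <= |y| and
    G x0 = 1. A real-linear functional is the real part of a unique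
    scalar-linear one ([exists_linear_re]), which inherits the bound, and then
    f(x0) is a scalar of modulus at most 1 with real part 1, that is, 1. *)

(** * Real and complex scalars treated uniformly *)

Section Scalars.
Variables (R : realType) (k : scalar_kind).
Local Notation K := (scalar_field R k).

Lemma re_scalarD (z w : K) : re_scalar (z + w) = re_scalar z + re_scalar w.
Proof. by case: k z w => [|] //= [a b] [c d]. Qed.

Lemma re_scalarN (z : K) : re_scalar (- z) = - re_scalar z.
Proof. by case: k z => [|] //= [a b]. Qed.

Lemma re_of_realM (a : R) (z : K) :
  re_scalar (of_real k a * z) = a * re_scalar z.
Proof. by case: k z => [|] //= [b c] /=; rewrite mul0r subr0. Qed.

Lemma re_of_real (a : R) : re_scalar (of_real k a) = a.
Proof. by case: k. Qed.

Lemma of_real1 : of_real k (1 : R) = 1.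
Proof. by case: k. Qed.

Lemma of_real0 : of_real k (0 : R) = 0.
Proof. by case: k. Qed.

Lemma of_realD (a b : R) : of_real k (a + b) = of_real k a + of_real k b.
Proof. by case: k => //=; rewrite rmorphD. Qed.

Lemma of_realM (a b : R) : of_real k (a * b) = of_real k a * of_real k b.
Proof. by case: k => //=; rewrite rmorphM. Qed.

Lemma ler_of_real (a b : R) : (of_real k a <= of_real k b) = (a <= b).
Proof. by case: k => //=; rewrite lecR. Qed.

Lemma norm_of_real (a : R) : `|of_real k a| = of_real k `|a|.
Proof.
by case: k => //=; rewrite normc_def /= expr0n /= addr0 sqrtr_sqr.
Qed.

Lemma of_real_re (z : K) : 0 <= z -> of_real k (re_scalar z) = z.
Proof.
by case: k z => [|] //= z z0; rewrite RRe_real// ger0_real.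
Qed.

Lemma re_scalar_le_norm (z : K) : re_scalar z <= re_scalar `|z|.
Proof.
case: k z => [|] /= z; first exact: ler_norm.
by rewrite (le_trans (ler_norm _))// -lecR (le_trans (normc_ge_Re z)).
Qed.

(** A norm is the real part of a rotated value: this is what reduces bounds on
    a scalar-linear functional to bounds on its real part. *)
Lemma exists_phase (z : K) :
  exists2 c : K, `|c| = 1 & re_scalar (c * z) = re_scalar `|z|.
Proof.
have [->|z0] := eqVneq z 0; first by exists 1; rewrite ?normr1// mulr0 normr0.
exists (`|z| / z); last by rewrite divfK.
by rewrite normrM normfV normr_id mulfV// normr_eq0.
Qed.

(** The line of scalars with real part 1 meets the closed unit disk only at 1.
    This gives [f u = 1] from the real part alone, so the derivative of the
    norm along [i u] is never computed. *)
Lemma re_norm_eq1 (z : K) : re_scalar z = 1 -> re_scalar `|z| <= 1 -> z = 1.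
Proof.
case: k z => [|] /=; first by [].
move=> [a b] /= -> {a}; rewrite expr1n => h.
suff -> : b = 0 by [].
apply/eqP; rewrite -sqrf_eq0 eq_le sqr_ge0 andbT.
have h0 : 0 <= 1 + b ^+ 2 by rewrite addr_ge0 ?sqr_ge0.
have := h; rewrite -(@ler_pXn2r _ 2)// ?nnegrE ?sqrtr_ge0// sqr_sqrtr// expr1n.
lra.
Qed.

Section Norm.
Variable V : normedModType K.
Implicit Types v w : V.

Lemma of_real_rnorm v : of_real k (rnorm v) = `|v|.
Proof. exact/of_real_re/normr_ge0. Qed.

Lemma rnorm_ge0 v : 0 <= rnorm v.
Proof.
by rewrite -ler_of_real of_real_rnorm of_real0.
Qed.

Lemma rnorm0 : rnorm (0 : V) = 0.
Proof. by rewrite /rnorm normr0 -of_real0 re_of_real. Qed.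

Lemma rnormZ (c : K) v : rnorm (c *: v) = re_scalar `|c| * rnorm v.
Proof.
by rewrite /rnorm normrZ -(@of_real_re `|c|)// re_of_realM re_of_real.
Qed.

Lemma rnormZ_real (a : R) v : rnorm (of_real k a *: v) = `|a| * rnorm v.
Proof. by rewrite rnormZ norm_of_real re_of_real. Qed.

Lemma rnormD v w : rnorm (v + w) <= rnorm v + rnorm w.
Proof.
by rewrite -ler_of_real of_realD !of_real_rnorm ler_normD.
Qed.

End Norm.

End Scalars.

(** * Linear functionals and their real parts *)

(** Over the complex numbers a linear functional is determined by its real part
    through f(y) = Re f(y) - i Re f(i y). *)
Lemma exists_linear_re (R : realType) (k : scalar_kind)
    (V : normedModType (scalar_field R k)) (G : V -> R) :
  (forall y z, G (y + z) = G y + G z) ->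
  (forall (t : R) y, G (of_real k t *: y) = t * G y) ->
  exists f : {linear V -> (scalar_field R k)^o},
    forall y, re_scalar (f y) = G y.
Proof.
case: k V G => V G GD GZ.
  have fl : linear (G : V -> R^o) by move=> a y z; rewrite GD GZ.
  pose m := GRing.isLinear.Build _ _ _ _ (G : V -> R^o) fl.
  pose f : {linear V -> R^o} := HB.pack (G : V -> R^o) m.
  by exists f.
pose F (y : V) : R[i]^o := Complex (G y) (- G (Complex 0 1 *: y)).
have fl : linear F.
  move=> [a b] y z; rewrite /F.
  (* Real-linearity expands G (z x) for a complex scalar z; linearity of F is
     this expansion at z = a + i b and at z = i (a + i b) = - b + i a. *)
  have h (c d : R) x :
      G (Complex c d *: x) = c * G x + d * G (Complex 0 1 *: x).
    have -> : Complex c d = of_real ComplexScalars c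
        + of_real ComplexScalars d * Complex 0 1.
      apply/eqP; rewrite eq_complex /=.
      by rewrite !mul0r !mulr0 !mulr1 !add0r subr0 !addr0 !eqxx.
    by rewrite scalerDl -scalerA GD !GZ.
  rewrite scalerDr scalerA !GD.
  have -> : Complex 0 1 * Complex a b = Complex (- b) a :> R[i].
    by apply/eqP; rewrite eq_complex /=; apply/andP; split; apply/eqP; ring.
  rewrite !(h a) !(h (- b)).
  by apply/eqP; rewrite eq_complex /=; apply/andP; split; apply/eqP; ring.
pose m := GRing.isLinear.Build _ _ _ _ F fl.
pose f : {linear V -> R[i]^o} := HB.pack F m.
by exists f.
Qed.


Section NormedSpace.
Variables (R : realType) (k : scalar_kind).
Local Notation K := (scalar_field R k).
Variable Y : completeNormedModType K.
Implicit Types (u v y z : Y) (a l m n t : R).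

Lemma rnorm_le_re (f : {linear Y -> K^o}) c y :
  (forall z, rnorm z = rnorm y -> re_scalar (f z) <= c) -> rnorm (f y) <= c.
Proof.
move=> h; have [w w1 e] := exists_phase (f y : K).
rewrite /rnorm -e.
have := h (w *: y); rewrite linearZ; apply.
by rewrite rnormZ w1 -(of_real1 R k) re_of_real mul1r.
Qed.

(** Rotations preserve the unit ball, so a bound for the real part there is a
    bound for the operator norm. *)
Lemma opnorm_le (f : {linear Y -> K^o}) c :
  (forall y, rnorm y <= 1 -> re_scalar (f y) <= c) -> opnorm f <= c.
Proof.
move=> h; apply: ge_sup.
  by exists (rnorm (f 0)), 0 => //; rewrite /unit_ball /= rnorm0 ler01.
move=> _ [y y1 <-]; apply: rnorm_le_re => z zy.
by apply: h; rewrite zy.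
Qed.

Lemma re_le_rnorm (f : {linear Y -> K^o}) v :
  opnorm f = 1 -> re_scalar (f v) <= rnorm v.
Proof.
move=> f1; have [v0|v0] := eqVneq (rnorm v) 0.
  have /eqP := of_real_rnorm v; rewrite v0 of_real0 eq_sym normr_eq0 => /eqP ->.
  by rewrite linear0 -[X in re_scalar X](of_real0 R k) re_of_real.
have vgt0 : 0 < rnorm v by rewrite lt_def v0 rnorm_ge0.
have bdd : has_sup [set rnorm (f y) | y in @unit_ball R k Y].
  (* The supremum of an unbounded set is 0 by convention, so a nonzero operator
     norm already says that f is bounded on the unit ball. *)
  apply: contrapT => /sup_out; rewrite -/(opnorm f) f1 => /eqP.
  by rewrite oner_eq0.
have : rnorm (f (of_real k (rnorm v)^-1 *: v)) <= 1.
  rewrite -f1; apply: ub_le_sup; first exact: bdd.2.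
  exists (of_real k (rnorm v)^-1 *: v) => //; rewrite /unit_ball /=.
  by rewrite rnormZ_real ger0_norm ?invr_ge0 ?rnorm_ge0// mulVf.
move=> /(le_trans (re_scalar_le_norm _)).
by rewrite linearZ re_of_realM ler_pdivrMl// mulr1.
Qed.

(** * The derivative of the norm *)

(** The derivative of the norm at a unit vector u in the direction y, with the
    limit multiplied out: in this form changing y by a real factor only
    rescales a, and no division is involved. *)
Definition norm_derivative u y l : Prop := forall e, 0 < e ->
  exists2 d, 0 < d & forall a, 0 < `|a| < d ->
    `|rnorm (u + of_real k a *: y) - 1 - a * l| <= e * `|a|.

Lemma norm_derivative_unit u : rnorm u = 1 -> norm_derivative u u 1.
Proof.
move=> u1 e e0; exists 1 => // a /andP[_ a1].
have -> : u + of_real k a *: u = of_real k (1 + a) *: u.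
  by rewrite of_realD of_real1 scalerDl scale1r.
rewrite rnormZ_real u1 !mulr1 (@ger0_norm _ (1 + a)); last first.
  by move: a1; rewrite ltr_norml => /andP[? ?]; lra.
have -> : 1 + a - 1 - a = 0 by ring.
by rewrite normr0 mulr_ge0// ltW.
Qed.

Lemma norm_derivativeZ u y l t :
  norm_derivative u y l -> rnorm u = 1 ->
  norm_derivative u (of_real k t *: y) (t * l).
Proof.
move=> D u1; have [->|t0] := eqVneq t 0.
  move=> e e0; exists 1 => // a _.
  rewrite of_real0 scale0r scaler0 addr0 u1 mul0r mulr0 !subrr normr0.
  by rewrite mulr_ge0// ltW.
have tgt0 : 0 < `|t| by rewrite normr_gt0.
move=> e e0; have [d d0 dP] := D (e / `|t|) (divr_gt0 e0 tgt0).
exists (d / `|t|); first exact: divr_gt0.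
move=> a /andP[a0 ad]; have := dP (a * t).
rewrite normrM mulr_gt0//= -ltr_pdivlMr// => /(_ ad).
by rewrite mulrCA divfK ?gt_eqF// scalerA -of_realM mulrA [e * _]mulrC.
Qed.

(** The sign of a is free, so the one inequality bounds both c and - c. *)
Lemma eq0_of_small c :
  (forall e, 0 < e -> exists2 d, 0 < d & forall a, 0 < `|a| < d ->
    a * c <= e * `|a|) -> c = 0 :> R.
Proof.
move=> h; apply/eqP; rewrite -normr_le0; apply/ler_addgt0Pl => e e0.
have [d d0 dP] := h e e0; rewrite addr0.
have d2 : 0 < `|d / 2| < d by rewrite gtr0_norm; lra.
have dN : 0 < `|- (d / 2)| < d by rewrite normrN.
have := dP _ d2; have := dP _ dN.
rewrite normrN gtr0_norm; last lra.
rewrite ler_norml => h1 h2; apply/andP; split; nra.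
Qed.

(** Convexity gives 2 |u + a (y + z)| <= |u + 2 a y| + |u + 2 a z|, hence
    a n <= a (l + m) up to o(a). For a > 0 this is subadditivity of the
    derivative and for a < 0 it is the reverse inequality. *)
Lemma norm_derivativeD u y z l m n :
  norm_derivative u y l -> norm_derivative u z m ->
  norm_derivative u (y + z) n -> n = l + m.
Proof.
move=> Dy Dz Ds; suff : n - (l + m) = 0 by lra.
apply: eq0_of_small => e e0.
have e3 : 0 < e / 3 by lra.
have [d1 d10 P1] := Dy _ e3.
have [d2 d20 P2] := Dz _ e3.
have [d3 d30 P3] := Ds _ e3.
(* The derivatives along y and z are used at 2 a, whence the factor 1 / 2. *)
exists (Num.min (Num.min d1 d2) d3 / 2).
  by rewrite divr_gt0// !lt_min d10 d20 d30.
move=> a /andP[a0]; rewrite ltr_pdivlMr// !lt_min => /andP[/andP[ad1 ad2] ad3].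
have a2 : `|2 * a| = `|a| * 2 by rewrite normrM mulrC (@ger0_norm _ 2).
have := P1 (2 * a); have := P2 (2 * a); have := P3 a.
have ad3' : `|a| < d3 by lra.
rewrite a2 mulr_gt0// a0 ad1 ad2 ad3' => /(_ isT) + /(_ isT) + /(_ isT).
rewrite !ler_norml => /andP[H3 _] /andP[_ H2] /andP[_ H1].
have : 2 * rnorm (u + of_real k a *: (y + z)) <=
    rnorm (u + of_real k (2 * a) *: y) + rnorm (u + of_real k (2 * a) *: z).
  apply: le_trans (rnormD _ _).
  rewrite -[X in X * _](@ger0_norm _ 2)// -rnormZ_real.
  suff -> : of_real k 2 *: (u + of_real k a *: (y + z)) =
    u + of_real k (2 * a) *: y + (u + of_real k (2 * a) *: z) by [].
  rewrite addrACA scalerDr scalerA -of_realM scalerDr; congr (_ + _).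
  by rewrite -[2]/(1 + 1) of_realD of_real1 scalerDl scale1r.
move=> ?; lra.
Qed.

(** Uniqueness is additivity in the form y = y + 0. *)
Lemma norm_derivative_unique u y l m :
  rnorm u = 1 -> norm_derivative u y l -> norm_derivative u y m -> l = m.
Proof.
move=> u1 Dl Dm.
have D0 : norm_derivative u 0 0.
  by have := norm_derivativeZ 0 Dl u1; rewrite of_real0 scale0r mul0r.
have := norm_derivativeD Dm D0 (n := l); rewrite !addr0; exact.
Qed.

Lemma norm_derivative_le u y l :
  rnorm u = 1 -> norm_derivative u y l -> l <= rnorm y.
Proof.
move=> u1 D; apply/ler_addgt0Pl => e e0; have [d d0 dP] := D e e0.
have d2 : 0 < `|d / 2| < d by rewrite gtr0_norm; lra.
have := dP _ d2; have := rnormD u (of_real k (d / 2) *: y).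
rewrite rnormZ_real u1 gtr0_norm; last lra.
rewrite ler_norml => ? /andP[? _]; nra.
Qed.

(** The derivative of the norm at u is the real part of a norm-one functional
    that attains its norm at u. *)
Lemma exists_support_functional u (G : Y -> R) :
  rnorm u = 1 -> (forall y, norm_derivative u y (G y)) ->
  exists f : {linear Y -> K^o},
    [/\ dual_sphere f, f u = 1 & forall y, re_scalar (f y) = G y].
Proof.
move=> u1 D.
have GD y z : G (y + z) = G y + G z by exact: (norm_derivativeD (D y) (D z)).
have GZ t y : G (of_real k t *: y) = t * G y.
  exact: (norm_derivative_unique u1 (D _) (norm_derivativeZ t (D y) u1)).
have [f fG] := exists_linear_re GD GZ.
have fle y : rnorm (f y) <= rnorm y.
  by apply: rnorm_le_re => z <-; rewrite fG; exact: norm_derivative_le (D z).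
have fu : f u = 1.
  apply: (@re_norm_eq1 R k); last by rewrite -u1; exact: fle.
  rewrite fG.
  exact: (norm_derivative_unique u1 (D u) (norm_derivative_unit u1)).
exists f; split => //; split => /=.
  apply: bounded_linear_continuous; apply/linear_boundedP.
  exists 1; split; first exact: rpred1.
  move=> r r1 y; rewrite -!of_real_rnorm -[leLHS]/(of_real k (rnorm (f y))).
  apply: (@le_trans _ _ (of_real k (rnorm y))); first by rewrite ler_of_real.
  rewrite ler_peMl ?(ltW r1)// of_real_rnorm; exact: normr_ge0.
apply/eqP; rewrite eq_le; apply/andP; split.
  apply: opnorm_le => y y1; rewrite fG.
  exact: le_trans (norm_derivative_le u1 (D y)) y1.
have -> : 1 = rnorm (f u) :> R.
  by rewrite fu /rnorm normr1 -(of_real1 R k) re_of_real.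
apply: ub_le_sup; first by exists 1 => _ [y y1 <-]; exact: le_trans (fle y) y1.
by exists u => //; rewrite /unit_ball /= u1.
Qed.

(** * Uniform smoothness and the BPB property *)

(** The second part is the only place where uniformity matters: the step a
    depends on e alone, and not on the unit vector u or the direction y. *)
Lemma uniformly_smooth_norm_derivative : uniformly_smooth Y ->
  exists G : Y -> Y -> R,
    (forall u y, rnorm u = 1 -> norm_derivative u y (G u y)) /\
    forall e, 0 < e -> exists2 a, 0 < a & forall u y, rnorm u = 1 ->
      rnorm y <= 1 -> rnorm (u + of_real k a *: y) - 1 <= a * (G u y + e).
Proof.
case=> L /= LP.
have {}LP e : 0 < e -> exists2 d, 0 < d & forall a, 0 < `|a| < d ->
    forall u y, rnorm u = 1 -> rnorm y <= 1 ->
    `|rnorm (u + of_real k a *: y) - 1 - a * L (u, y)| <= e * `|a|.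
  move=> e0.
  have /LP : nbhs (L : {uniform` @unit_sphere R k Y `*` @unit_ball R k Y -> R})
      [set h | forall p, (@unit_sphere R k Y `*` @unit_ball R k Y) p ->
        ball (L p) e (h p)].
    apply/uniform_nbhs; exists [set xy | ball xy.1 e xy.2]; split => //.
    exact: (entourage_ball _ (PosNum e0)).
  move=> [d d0 dP]; exists d => // a /andP[a0 ad] u y u1 y1.
  have /(_ (u, y)) : forall p, (@unit_sphere R k Y `*` @unit_ball R k Y) p ->
      ball (L p) e (@difference_quotient R k Y a p).
    apply: dP; last by rewrite -normr_gt0.
    by rewrite /= sub0r normrN.
  move=> /(_ (conj u1 y1)); rewrite /ball /= /difference_quotient /= => h.
  rewrite -ler_pdivrMr// -normfV -normrM mulrBl mulrAC mulfV -?normr_gt0//.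
  by rewrite mul1r distrC ltW.
(* The limit L is only meaningful for directions in the unit ball, so it is
   extended by homogeneity; the scaling t y is 1 on the ball, where nothing
   changes. *)
pose t (y : Y) := Num.max 1 (rnorm y).
have t1 y : 1 <= t y by rewrite le_max lexx.
have tinv y : rnorm (of_real k (t y)^-1 *: y) <= 1.
  rewrite rnormZ_real normfV ger0_norm ?(le_trans _ (t1 y))//.
  by rewrite ler_pdivrMl ?(lt_le_trans _ (t1 y))// mulr1 le_max lexx orbT.
exists (fun u y => t y * L (u, of_real k (t y)^-1 *: y)); split.
  move=> u y u1.
  have -> : norm_derivative u y = norm_derivative u
      (of_real k (t y) *: (of_real k (t y)^-1 *: y)).
    rewrite scalerA -of_realM mulfV ?of_real1 ?scale1r//.
    by rewrite gt_eqF// (lt_le_trans _ (t1 y)).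
  apply: norm_derivativeZ => // e e0; have [d d0 dP] := LP e e0.
  by exists d => // a ad; exact: dP.
move=> e e0; have [d d0 dP] := LP e e0.
have d2 : 0 < `|d / 2| < d by rewrite gtr0_norm; lra.
exists (d / 2) => [|u y u1 y1]; first lra.
have -> : t y = 1 by rewrite /t max_l.
rewrite invr1 of_real1 scale1r mul1r.
have := dP _ d2 u y u1 y1; rewrite [`|d / 2|]gtr0_norm; last lra.
by rewrite ler_norml => /andP[_ ?]; lra.
Qed.

End NormedSpace.

Theorem proposition4p9 (R : realType) (k : scalar_kind)
    (Y : completeNormedModType (scalar_field R k)) :
  uniformly_smooth Y -> BPB_property Y.
Proof.
move=> /uniformly_smooth_norm_derivative[G [GD GU]] X _ eps eps0.
have e4 : 0 < eps / 4 by lra.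
have [a a0 aP] := GU _ e4.
exists (a * (eps / 4)) => [|x0 y0 [X0 x01] [_ y01] y0x0]; first exact: mulr_gt0.
have [f [fS fx0 fG]] := exists_support_functional x01 (fun y => GD _ y x01).
exists (x0, f); split => //=; first by rewrite subrr rnorm0.
(* The norm is a supremum, so the strict pointwise bound only passes to it as a
   weak one: eps / 2 leaves the room needed. *)
apply: (@le_lt_trans _ _ (eps / 2)); last lra.
apply: (@opnorm_le _ _ _ (y0 \- f)) => y y1 /=.
rewrite re_scalarD re_scalarN fG.
have := re_le_rnorm (x0 + of_real k a *: y) y01.
rewrite linearD linearZ re_scalarD re_of_realM.
have := aP x0 y x01 y1 => H1 H2; nra.
Qed.
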